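(* Let $q$ be a complex number with $q\neq 0,1$, let $m,r_1,r_2$ be complex numbers and set $r=r_1+r_2$. For all non-negative integers $n$ and $k$, $$w_{m,r,q}(n,k)=\sum_{j=k}^n\binom{j}{k}(-r_2)^{j-k}\,w_{m,r_1,q}(n,j)$$ and $$W_{m,r,q}(n,k)=\sum_{j=k}^n\binom{n}{j}r_2^{\,n-j}\,W_{m,r_1,q}(j,k).$$
   Context: $[\ell]_q=\frac{q^\ell-1}{q-1}$. For complex $m,s$, the $(q,r)$-Whitney numbers of the first kind $w_{m,s,q}(n,k)$ are defined by $m^n(a^\dagger)^n a^n=\sum_{k=0}^{n}w_{m,s,q}(n,k)(ma^\dagger a+s)^k$ with $q$-boson operators $aa^\dagger-qa^\dagger a=1$; equivalently $w_{m,s,q}(0,0)=1$, $w_{m,s,q}(n,k)=0$ for $k<0$ or $k>n$, and $w_{m,s,q}(n+1,k)=q^{-n}\big(w_{m,s,q}(n,k-1)-(m[n]_q+s)w_{m,s,q}(n,k)\big)$. The $(q,r)$-Whitney numbers of the second kind $W_{m,s,q}(n,k)$ are defined by $(ma^\dagger a+s)^n=\sum_{k=0}^{n}m^kW_{m,s,q}(n,k)(a^\dagger)^k a^k$; equivalently $W_{m,s,q}(0,0)=1$, $W_{m,s,q}(n,k)=0$ for $k<0$ or $k>n$, and $W_{m,s,q}(n+1,k)=q^{k-1}W_{m,s,q}(n,k-1)+(m[k]_q+s)W_{m,s,q}(n,k)$. *)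

(* Defs.v *)
From HB Require Import structures.
From mathcomp Require Import all_boot all_order all_algebra.
From mathcomp Require Import ring reals complex.
Set Implicit Arguments.
Unset Strict Implicit.
Unset Printing Implicit Defensive.
Import Order.TTheory GRing.Theory Num.Theory.
Local Open Scope ring_scope.

Definition qnat (F : fieldType) (q : F) (l : nat) : F :=
  (q ^+ l - 1) / (q - 1).

(* The recurrences below, unlike the q-boson expansions, determine the numbers
   also for m = 0. The index k is a natural number; terms with k - 1 < 0 are 0,
   and vanishing for k > n follows from the recurrence (qwhitney1_gt,
   qwhitney2_gt). *)
Fixpoint qwhitney1 (F : fieldType) (m s q : F) (n k : nat) : F :=
  match n with
  | 0 => (k == 0)%N%:R
  | n'.+1 =>
      q ^- n' * ((if k is k'.+1 then qwhitney1 m s q n' k' else 0)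
                 - (m * qnat q n' + s) * qwhitney1 m s q n' k)
  end.

Fixpoint qwhitney2 (F : fieldType) (m s q : F) (n k : nat) : F :=
  match n with
  | 0 => (k == 0)%N%:R
  | n'.+1 =>
      (if k is k'.+1 then q ^+ k' * qwhitney2 m s q n' k' else 0)
      + (m * qnat q k + s) * qwhitney2 m s q n' k
  end.

Lemma qwhitney1_gt (F : fieldType) (m s q : F) (n k : nat) :
  (n < k)%N -> qwhitney1 m s q n k = 0.
Proof.
elim: n k => [|n IHn] [|k] //= nk.
by rewrite !IHn ?mulr0 ?subr0 ?mulr0 // ltnW.
Qed.

Lemma qwhitney2_gt (F : fieldType) (m s q : F) (n k : nat) :
  (n < k)%N -> qwhitney2 m s q n k = 0.
Proof.
elim: n k => [|n IHn] [|k] //= nk.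
by rewrite !IHn ?mulr0 ?addr0 // ltnW.
Qed.

Lemma qnatS (F : fieldType) (q : F) (l : nat) :
  q != 1 -> qnat q l.+1 = q ^+ l + qnat q l.
Proof.
move=> q1; rewrite /qnat exprS; field.
by rewrite subr_eq0.
Qed.

Lemma qboson_comm (F : fieldType) (A : algType F) (q : F) (a ad : A) (l : nat) :
    q != 1 -> a * ad - q *: (ad * a) = 1 ->
  a * ad ^+ l = q ^+ l *: (ad ^+ l * a) + qnat q l *: ad ^+ l.-1.
Proof.
move=> q1 /eqP; rewrite subr_eq => /eqP aad.
elim: l => [|l IHl].
  by rewrite /qnat !expr0 subrr mul0r !scale0r addr0 scale1r mulr1 mul1r.
rewrite [ad ^+ l.+1]exprSr mulrA IHl mulrDl -!scalerAl.
rewrite -[ad ^+ l * a * ad]mulrA aad mulrDr mulr1 -scalerAr scalerDr scalerA.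
rewrite [ad ^+ l * (ad * a)]mulrA -!exprSr qnatS // scalerDl /=.
case: l {IHl} => [|l] /=; last first.
  by rewrite addrA [q ^+ l.+2 *: _ + _]addrC.
by rewrite /qnat !expr0 subrr mul0r !scale0r !addr0 addrC.
Qed.

Lemma qwhitney1_qboson (F : fieldType) (A : algType F) (m s q : F) (a ad : A)
    (n : nat) :
    q != 0 -> q != 1 -> a * ad - q *: (ad * a) = 1 ->
  m ^+ n *: (ad ^+ n * a ^+ n) =
  \sum_(k < n.+1) qwhitney1 m s q n k *: (m *: (ad * a) + s *: 1) ^+ k.
Proof.
move=> q0 q1 aad; set X := m *: _ + _.
elim: n => [|n IHn].
  by rewrite big_ord1 /= !expr0 mulr1.
have E : m ^+ n.+1 *: (ad ^+ n.+1 * a ^+ n.+1) =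
    q ^- n *: ((X - (m * qnat q n + s) *: 1) * (m ^+ n *: (ad ^+ n * a ^+ n))).
  have adaE : ad ^+ n.+1 * a = q ^- n *: ((ad * a - qnat q n *: 1) * ad ^+ n).
    rewrite mulrBl -mulrA (qboson_comm n q1 aad) mulrDr -!scalerAr -scalerAl.
    rewrite mul1r [ad * (_ * a)]mulrA -exprS.
    have -> : qnat q n *: (ad * ad ^+ n.-1) = qnat q n *: ad ^+ n.
      case: (n) => [|l] /=; last by rewrite -exprS.
      by rewrite /qnat expr0 subrr mul0r !scale0r.
    by rewrite addrK scalerA mulVf ?scale1r // expf_neq0.
  have -> : X - (m * qnat q n + s) *: 1 = m *: (ad * a - qnat q n *: 1).
    by rewrite /X scalerBr scalerA scalerDl opprD addrA addrAC addrK.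
  rewrite [a ^+ n.+1]exprS mulrA adaE -!scalerAl -scalerAr -!mulrA !scalerA.
  by congr (_ *: _); rewrite exprS mulrC mulrA.
rewrite E IHn mulrBl -scalerAl mul1r [RHS]big_ord_recl /= expr0 sub0r.
rewrite scalerBr mulr_sumr !scaler_sumr.
rewrite [X in _ - X]big_ord_recl /= expr0.
under [in RHS]eq_bigr => i _ do rewrite /bump /= add1n mulrBr scalerBl.
rewrite sumrB [X in _ = _ + (_ - X)]big_ord_recr /=.
rewrite (qwhitney1_gt _ _ _ (ltnSn n)) !mulr0 scale0r addr0.
rewrite mulrN scaleNr [RHS]addrCA opprD; congr (_ + (_ - _)).
- by apply: eq_bigr => i _; rewrite add0n -scalerAr -exprS scalerA.
- by rewrite !scalerA -!mulrA.
- by apply: eq_bigr => i _; rewrite /bump /= !scalerA -!mulrA.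
Qed.

Lemma qwhitney2_qboson (F : fieldType) (A : algType F) (m s q : F) (a ad : A)
    (n : nat) :
    q != 1 -> a * ad - q *: (ad * a) = 1 ->
  (m *: (ad * a) + s *: 1) ^+ n =
  \sum_(k < n.+1) (m ^+ k * qwhitney2 m s q n k) *: (ad ^+ k * a ^+ k).
Proof.
move=> q1 aad; set X := m *: _ + _.
have XE k : X * (ad ^+ k * a ^+ k) =
    (m * q ^+ k) *: (ad ^+ k.+1 * a ^+ k.+1)
    + (m * qnat q k + s) *: (ad ^+ k * a ^+ k).
  rewrite /X mulrDl -!scalerAl mul1r scalerDl addrA; congr (_ + _).
  rewrite -[ad * a * _]mulrA [a * (_ * _)]mulrA (qboson_comm k q1 aad).
  rewrite mulrDl mulrDr scalerDr -!scalerAl -!scalerAr !scalerA.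
  congr (_ *: _ + _); first by rewrite -mulrA -exprS mulrA -exprS.
  case: k => [|k] /=; last by rewrite mulrA -exprS.
  by rewrite /qnat expr0 subrr mul0r !mulr0 !scale0r.
elim: n => [|n IHn].
  by rewrite big_ord1 /= !expr0 !mulr1 scale1r.
rewrite exprS IHn mulr_sumr.
under eq_bigr => i _ do rewrite -scalerAr XE scalerDr !scalerA.
rewrite big_split /= [RHS]big_ord_recl /= !expr0 add0r.
under [in RHS]eq_bigr => i _ do rewrite /bump /= add1n mulrDr scalerDl.
rewrite big_split /= [X in _ = _ + (_ + X)]big_ord_recr /=.
rewrite (qwhitney2_gt _ _ _ (ltnSn n)) !mulr0 scale0r addr0.
rewrite [RHS]addrCA; congr (_ + _).
  apply: eq_bigr => i _; congr (_ *: _); rewrite add0n exprS; ring.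
rewrite big_ord_recl /= !expr0; congr (_ + _).
  by rewrite !mul1r mulrC.
by apply: eq_bigr => i _; congr (_ *: _); rewrite -mulrA [_ * (m * _ + s)]mulrC.
Qed.

(* Main.v *)
(** The polynomials P_{n,s} = \sum_k w_{m,s,q}(n,k) X^k satisfy
    P_{n+1,s} = q^{-n} (X - s - m[n]_q) P_{n,s}, so that
    P_{n,r1+r2}(X) = P_{n,r1}(X - r2); compare coefficients of X^k.
    For the second kind, the binomial transform T f n = \sum_j C(n,j) c^{n-j} f j
    satisfies T f (n+1) = c T f n + T (f \o succ) n, so that transforming the
    recurrence for s gives the recurrence for s + c. *)
Require Import Defs.
From mathcomp Require Import all_boot all_order all_algebra.
From mathcomp Require Import reals complex.
From mathcomp Require Import ring.
Import Order.TTheory GRing.Theory Num.Theory.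
Local Open Scope ring_scope.

(** Frees the range from [k]: below [k] the first-kind terms vanish through C(j, k), the second-kind
    ones through W(j, k). *)
Lemma sum_nat_lowered {V : nmodType} (k n : nat) (f : nat -> V) :
    (forall j, (j < k)%N -> f j = 0) ->
  \sum_(k <= j < n) f j = \sum_(j < n) f j.
Proof.
move=> f0; rewrite big_geq_mkord big_mkcond /=; apply: eq_bigr => j _.
by case: leqP => // /f0.
Qed.

Definition binomial_transform {S : comPzRingType} (c : S) (f : nat -> S)
    (n : nat) : S :=
  \sum_(j < n.+1) 'C(n, j)%:R * c ^+ (n - j) * f j.

(** Pascal's rule: the C(n, j+1) parts, with the term of index 0, give the first summand; the C(n,
    j) parts give the second. *)
Lemma binomial_transformS {S : comPzRingType} (c : S) (f : nat -> S) (n : nat) :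
  binomial_transform c f n.+1 =
    c * binomial_transform c f n
    + binomial_transform c (fun j => f j.+1) n.
Proof.
rewrite /binomial_transform big_ord_recl /= !bin0 subn0.
under eq_bigr => i _ do
  rewrite /bump /= add1n binS natrD 2!mulrDl subSS.
rewrite big_split /= addrA; congr (_ + _).
rewrite big_ord_recr /= bin_small // !mul0r addr0 [in RHS]big_ord_recl /=.
rewrite bin0 subn0 mulrDr exprS !mul1r -mulrA mulr_sumr; congr (_ + _).
apply: eq_bigr => i _; rewrite /bump /= add1n.
(* As i < n, the exponent n - i is a successor and releases the factor [c]. *)
by rewrite -(subnSK (ltn_ord i)) exprS; ring.
Qed.

Lemma coef_XsubC_exp {S : comNzRingType} (c : S) (n k : nat) :
  (('X - c%:P) ^+ n)`_k = 'C(n, k)%:R * (- c) ^+ (n - k).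
Proof.
(* With the constant first, [exprDn] gives 'X the exponent i, so only i = k contributes. *)
rewrite addrC -polyCN exprDn coef_sum.
under eq_bigr => i _ do
  rewrite -polyC_exp coefMn coefCM coefXn mulr_natr -mulrnA mulnC.
have [kn|nk] := leqP k n.
  rewrite (bigD1 (inord k)) //= inordK // eqxx muln1 mulr_natl big1 ?addr0 //.
  move=> i /eqP ik; case: eqP => [E|]; last by rewrite muln0.
  by case: ik; apply: val_inj; rewrite /= inordK.
rewrite bin_small // mul0r big1 // => i _.
by rewrite gtn_eqF ?muln0 // (leq_ltn_trans _ nk) // -ltnS.
Qed.

Definition qwhitney1_poly {F : fieldType} (m s q : F) (n : nat) : {poly F} :=
  \poly_(k < n.+1) qwhitney1 m s q n k.

Lemma coef_qwhitney1_poly {F : fieldType} (m s q : F) (n k : nat) :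
  (qwhitney1_poly m s q n)`_k = qwhitney1 m s q n k.
Proof.
by rewrite coef_poly; case: ltnP => // nk; rewrite qwhitney1_gt.
Qed.

Lemma qwhitney1_polyS {F : fieldType} (m s q : F) (n : nat) :
  qwhitney1_poly m s q n.+1 =
    q ^- n *: (('X - (m * qnat q n + s)%:P) * qwhitney1_poly m s q n).
Proof.
apply/polyP => k.
rewrite coefZ mulrBl coefB coefXM coefCM !coef_qwhitney1_poly /=.
by case: k.
Qed.

Lemma qwhitney1_poly_shift {F : fieldType} (m s c q : F) (n : nat) :
  qwhitney1_poly m (s + c) q n = qwhitney1_poly m s q n \Po ('X - c%:P).
Proof.
elim: n => [|n IHn].
  suff E t : qwhitney1_poly m t q 0 = 1 by rewrite !E comp_polyC.
  by apply/polyP => k; rewrite coef_qwhitney1_poly coef1.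
rewrite !qwhitney1_polyS comp_polyZ comp_polyM -IHn comp_polyB comp_polyX.
by rewrite comp_polyC -addrA -opprD -polyCD addrA [c + _]addrC.
Qed.

Lemma qwhitney1_shift {F : fieldType} (m s c q : F) (n k : nat) :
  qwhitney1 m (s + c) q n k =
    \sum_(k <= j < n.+1)
      'C(j, k)%:R * (- c) ^+ (j - k) * qwhitney1 m s q n j.
Proof.
rewrite sum_nat_lowered => [|j jk]; last by rewrite bin_small // !mul0r.
rewrite -coef_qwhitney1_poly qwhitney1_poly_shift.
(* Composition is additive: each X^j turns into (X - c)^j. *)
rewrite /qwhitney1_poly poly_def raddf_sum coef_sum; apply: eq_bigr => j _ /=.
by rewrite comp_polyZ comp_Xn_poly coefZ coef_XsubC_exp mulrC.
Qed.

Lemma qwhitney2_shift {F : fieldType} (m s c q : F) (n k : nat) :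
  qwhitney2 m (s + c) q n k =
    \sum_(k <= j < n.+1) 'C(n, j)%:R * c ^+ (n - j) * qwhitney2 m s q j k.
Proof.
rewrite sum_nat_lowered => [|j jk]; last by rewrite qwhitney2_gt ?mulr0.
rewrite -/(binomial_transform c (fun j => qwhitney2 m s q j k) n).
(* [k] stays general because the recurrence also calls on k - 1. *)
elim: n k => [|n IHn] k.
  by rewrite /binomial_transform big_ord1 /= bin0 !mul1r.
rewrite binomial_transformS -IHn /=.
(* The recurrence coefficients depend on [k] but not on j, so they pass through the transform. *)
have -> : binomial_transform c (fun j => qwhitney2 m s q j.+1 k) n =
    (if k is k'.+1 then q ^+ k' * qwhitney2 m (s + c) q n k' else 0)
    + (m * qnat q k + s) * qwhitney2 m (s + c) q n k.
  rewrite [in RHS]IHn /binomial_transform mulr_sumr.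
  case: k => [|k]; last rewrite IHn /binomial_transform mulr_sumr -big_split.
    by rewrite add0r; apply: eq_bigr => j _ /=; ring.
  by apply: eq_bigr => j _ /=; ring.
(* The extra [c] joins m[k] + s to form m[k] + (s + c). *)
by case: k => [|k]; ring.
Qed.

Theorem theorem6 (R : realType) (q m r1 r2 r : R[i])
    (hq0 : q != 0) (hq1 : q != 1) (hr : r = r1 + r2) (n k : nat) :
  qwhitney1 m r q n k =
    \sum_(k <= j < n.+1)
      'C(j, k)%:R * (- r2) ^+ (j - k) * qwhitney1 m r1 q n j
  /\
  qwhitney2 m r q n k =
    \sum_(k <= j < n.+1)
      'C(n, j)%:R * r2 ^+ (n - j) * qwhitney2 m r1 q j k.
Proof. by rewrite hr; split; [exact: qwhitney1_shift | exact: qwhitney2_shift]. Qed.
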